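(* Let $G$ be a (Gromov) hyperbolic group and let $\phi: G\to Q$ be a homomorphism to a finitely generated abelian group $Q$ such that the kernel $N:=\ker(\phi)$ is finitely presented. Then there is a polynomial $p(n)$ such that the Dehn function of $N$ satisfies $\delta_N(n)\leq p(n)$ for all $n$.
   Context: Let $H$ be a group with finite presentation $\mathcal{P}=\langle X\mid R\rangle$ and let $F_X$ be the free group on $X$. A word $w$ in $X^{\pm 1}$ is null-homotopic if it represents the trivial element of $H$. Its area $\mathrm{Area}_{\mathcal{P}}(w)$ is the minimal $k$ such that in $F_X$ one has $w=\prod_{i=1}^k u_i r_i u_i^{-1}$ with $r_i\in R^{\pm1}$ and $u_i\in F_X$. The Dehn function of $H$ with respect to $\mathcal{P}$ is $\delta_{H,\mathcal{P}}(n):=\max\{\mathrm{Area}_{\mathcal{P}}(w)\mid w \text{ null-homotopic},\ \ell(w)\leq n\}$, where $\ell(w)$ is the length of $w$. Dehn functions of different finite presentations of $H$ are asymptotically equivalent: for $f_1,f_2$ write $f_1\preccurlyeq f_2$ if there is a constant $C\geq 1$ with $f_1(n)\leq C f_2(Cn+C)+Cn+C$ for all $n$, and $f_1\asymp f_2$ if $f_1\preccurlyeq f_2\preccurlyeq f_1$. One writes $\delta_H$ for $\delta_{H,\mathcal{P}}$ with respect to a finite presentation; the property of being bounded above by a polynomial does not depend on the choice of finite presentation. *)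

(* Defs.v *)
From HB Require Import structures.
From mathcomp Require Import all_boot all_order all_algebra.
From mathcomp Require Import boolp classical_sets.

Set Implicit Arguments.
Unset Strict Implicit.
Unset Printing Implicit Defensive.

Import Order.TTheory GRing.Theory Num.Theory.

(* Minimum of a nonempty set of naturals; the value on the empty set is 0. *)
Definition least (P : nat -> Prop) : nat :=
  xget 0 [set k | P k /\ forall j, P j -> k <= j]%classic.

(* The letter (x, false) stands for x and (x, true) for x^-1. *)
Definition letter (X : finType) : Type := (X * bool)%type.

Definition word (X : finType) : Type := seq (X * bool).

Definition linv (X : finType) (a : letter X) : letter X := (a.1, ~~ a.2).

Definition winv (X : finType) (w : word X) : word X := rev (map (@linv X) w).

(* F_X is the set of words modulo freely_equal, with concatenation as product. *)
Inductive freely_equal (X : finType) : word X -> word X -> Prop :=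
| freely_equal_cancel u (a : letter X) v :
    freely_equal (u ++ a :: linv a :: v) (u ++ v)
| freely_equal_refl w : freely_equal w w
| freely_equal_sym w1 w2 : freely_equal w1 w2 -> freely_equal w2 w1
| freely_equal_trans w1 w2 w3 :
    freely_equal w1 w2 -> freely_equal w2 w3 -> freely_equal w1 w3.

Definition symmetrized (X : finType) (R : seq (word X)) : seq (word X) :=
  R ++ map (@winv X) R.

(* The pairs are the (u_i, r_i), in order. *)
Definition conj_prod (X : finType) (c : seq (word X * word X)) : word X :=
  flatten [seq p.1 ++ p.2 ++ winv p.1 | p <- c].

Definition is_conj_prod (X : finType) (R : seq (word X)) (k : nat)
    (w : word X) : Prop :=
  exists c : seq (word X * word X),
    [/\ size c = k, (forall p, p \in c -> p.2 \in symmetrized R)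
      & freely_equal w (conj_prod c)].

Definition area (X : finType) (R : seq (word X)) (w : word X) : nat :=
  least (fun k => is_conj_prod R k w).

Definition eval_letter (H : groupType) (X : finType) (f : X -> H)
    (a : letter X) : H :=
  if a.2 then (f a.1)^-1%g else f a.1.

Definition eval (H : groupType) (X : finType) (f : X -> H) (w : word X) : H :=
  (\prod_(a <- w) eval_letter f a)%g.

Definition generates (H : groupType) (X : finType) (f : X -> H) : Prop :=
  forall h : H, exists w : word X, eval f w = h.

Definition finitely_generated (H : groupType) : Prop :=
  exists (X : finType) (f : X -> H), generates f.

(* pres_ker says that the kernel of F_X -> H is the normal closure of R. *)
Record finite_presentation (H : groupType) := FinitePresentation {
  pres_gens : finType;
  pres_rels : seq (word pres_gens);
  pres_map : pres_gens -> H;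
  pres_generates : generates pres_map;
  pres_ker : forall w : word pres_gens,
    eval pres_map w = 1%g <-> exists k, is_conj_prod pres_rels k w }.

Definition finitely_presented (H : groupType) : Prop :=
  inhabited (finite_presentation H).

Definition null_homotopic (H : groupType) (P : finite_presentation H)
    (w : word (pres_gens P)) : Prop :=
  eval (@pres_map H P) w = 1%g.

Definition dehn (H : groupType) (P : finite_presentation H) (n : nat) : nat :=
  \max_(l < n.+1)
    \max_(w : l.-tuple (pres_gens P * bool) | `[< null_homotopic (w : word _) >])
      area (pres_rels P) w.

(* Meaningful when f generates H. *)
Definition word_norm (H : groupType) (X : finType) (f : X -> H) (h : H) : nat :=
  least (fun k => exists w : word X, size w = k /\ eval f w = h).

Definition word_dist (H : groupType) (X : finType) (f : X -> H) (x y : H) : nat :=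
  word_norm f (x^-1 * y)%g.

Definition gromov_product (T : Type) (d : T -> T -> nat) (o x y : T) : rat :=
  (((d o x)%:R + (d o y)%:R - (d x y)%:R) / 2)%R.

Definition gromov_hyperbolic (T : Type) (d : T -> T -> nat) : Prop :=
  exists2 delta : rat, (0 <= delta)%R &
    forall o x y z : T,
      (Num.min (gromov_product d o x y) (gromov_product d o y z) - delta
        <= gromov_product d o x z)%R.

Definition hyperbolic_group (H : groupType) : Prop :=
  exists (X : finType) (f : X -> H),
    generates f /\ gromov_hyperbolic (word_dist f).

Definition kernel_pred (G Q : groupType) (phi : {multiplicative G -> Q}) :
  {pred G} := fun x => phi x == 1%g.

Record kernel (G Q : groupType) (phi : {multiplicative G -> Q}) : Type :=
  Kernel { kernel_val :> G; _ : kernel_val \in kernel_pred phi }.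

Section KernelGroup.
Variables (G Q : groupType) (phi : {multiplicative G -> Q}).

Lemma kernel_group_closed : group_closed (kernel_pred phi).
Proof.
have phi1 : phi 1%g = 1%g.
  by apply: (mulgI (phi 1%g)); rewrite -gmulfM !mulg1.
have phiV x : phi x^-1%g = (phi x)^-1%g.
  by apply: (mulgI (phi x)); rewrite -gmulfM !mulgV phi1.
split; first by rewrite unfold_in phi1.
move=> x y; rewrite !unfold_in => /eqP px /eqP py.
by rewrite gmulfM phiV px py invg1 mulg1.
Qed.

HB.instance Definition _ := [isSub for @kernel_val G Q phi].
HB.instance Definition _ := [Choice of kernel phi by <:].
HB.instance Definition _ :=
  SubChoice_isSubGroup.Build G (kernel_pred phi) (kernel phi)
    kernel_group_closed.
End KernelGroup.

(* Main.v *)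
(* For a loop of length n in N, cone it off from the identity by geodesics of
   G. Consecutive geodesics fellow-travel, which gives O(n^2) cells of bounded
   size, and by the iterated four-point inequality every vertex lies within
   O(log n) of the loop, so its image in Q has length O(log n).

   The diagram is then pushed into N. Q has coordinates that are Lipschitz and
   assemble back to the element; clamping them to [-k, k] for k decreasing moves
   every vertex to N in O(log n) steps, while the images in Q of neighbouring
   vertices stay uniformly close. One step conjugates by an element of a finite
   set and multiplies by corrections from a finite set, so lengths and areas are
   multiplied by a constant. The pushed cells therefore have N-area exponential
   in log n, that is, polynomial in n. *)

From HB Require Import structures.
From mathcomp Require Import all_boot all_order all_algebra.
From mathcomp Require Import boolp classical_sets.
From mathcomp Require Import zify lra.
Require Import Defs.

Set Implicit Arguments.
Unset Strict Implicit.
Unset Printing Implicit Defensive.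

Import Order.TTheory GRing.Theory Num.Theory.

(** * Minima of sets of naturals and uniform constants *)

Lemma least_spec (P : nat -> Prop) k :
  P k -> P (least P) /\ forall j, P j -> least P <= j.
Proof.
move=> Pk.
have exP : exists j, `[< P j >] by exists k; apply/asboolP.
have [j /asboolP Pj jmin] := ex_minnP exP.
apply: (@xgetPex _ 0 [set i | P i /\ forall i', P i' -> i <= i']%classic).
by exists j; split=> // i Pi; apply: jmin; apply/asboolP.
Qed.

Lemma least_le (P : nat -> Prop) k : P k -> least P <= k.
Proof. by move=> Pk; apply: (least_spec Pk).2. Qed.

Lemma leastP (P : nat -> Prop) : (exists k, P k) -> P (least P).
Proof. by move=> [k /least_spec[]]. Qed.

Lemma uniform_bound (T : eqType) (s : seq T) (P : T -> nat -> Prop) :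
    (forall x k l, k <= l -> P x k -> P x l) ->
    (forall x, x \in s -> exists k, P x k) ->
  exists K, forall x, x \in s -> P x K.
Proof.
move=> monoP; elim: s => [|x s IHs] exP; first by exists 0.
have [K PK] := IHs (fun y ys => exP y (@mem_behead _ (x :: s) y ys)).
have [k Pk] := exP x (mem_head x s).
exists (maxn K k) => y; rewrite inE => /predU1P[->|ys].
  exact: monoP (leq_maxr _ _) Pk.
exact: monoP (leq_maxl _ _) (PK y ys).
Qed.

(** * Words *)

Section Words.
Variable X : finType.
Implicit Types (u v w : word X) (a : letter X).

Lemma linvK : involutive (@linv X).
Proof. by case=> x b; rewrite /linv negbK. Qed.

Lemma winv_cat u v : winv (u ++ v) = winv v ++ winv u.
Proof. by rewrite /winv map_cat rev_cat. Qed.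

Lemma winv_cons a w : winv (a :: w) = winv w ++ [:: linv a].
Proof. by rewrite -cat1s winv_cat. Qed.

Lemma winvK : involutive (@winv X).
Proof. by move=> w; rewrite /winv map_rev revK (mapK linvK). Qed.

Lemma size_winv w : size (winv w) = size w.
Proof. by rewrite size_rev size_map. Qed.

Lemma freely_equal_ctx p q u v :
  freely_equal u v -> freely_equal (p ++ u ++ q) (p ++ v ++ q).
Proof.
elim=> [u' a v'|w|w1 w2 _|w1 w2 w3 _ + _].
- by have := freely_equal_cancel (p ++ u') a (v' ++ q); rewrite -!catA.
- exact: freely_equal_refl.
- exact: freely_equal_sym.
- exact: freely_equal_trans.
Qed.

Lemma freely_equal_winv u v : freely_equal u v -> freely_equal (winv u) (winv v).
Proof.
elim=> [u' a v'|w|w1 w2 _|w1 w2 w3 _ + _].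
- rewrite !winv_cat !winv_cons linvK -!catA.
  exact: (freely_equal_cancel (winv v') a (winv u')).
- exact: freely_equal_refl.
- exact: freely_equal_sym.
- exact: freely_equal_trans.
Qed.

Lemma freely_equal_mulV p w q : freely_equal (p ++ w ++ winv w ++ q) (p ++ q).
Proof.
elim: w p q => [|a w IHw] p q; first exact: freely_equal_refl.
rewrite winv_cons -cat1s -!catA.
have := IHw (p ++ [:: a]) ([:: linv a] ++ q).
rewrite -!catA => /freely_equal_trans; apply.
exact: freely_equal_cancel.
Qed.

Lemma freely_equal_Vmul p w q : freely_equal (p ++ winv w ++ w ++ q) (p ++ q).
Proof. by have := freely_equal_mulV p (winv w) q; rewrite winvK. Qed.

End Words.

(** * Counting relator applications *)

Section Rewriting.
Variables (X : finType) (R : seq (word X)).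
Implicit Types (u v w : word X) (k l : nat).

(* [weq k u v]: the word [u] can be turned into [v] by free reductions and
   expansions and at most [k] insertions or deletions of relators. *)
Inductive weq : nat -> word X -> word X -> Prop :=
| weq_refl w : weq 0 w w
| weq_cancel u (a : letter X) v : weq 0 (u ++ a :: linv a :: v) (u ++ v)
| weq_rel u r v : r \in R -> weq 1 (u ++ r ++ v) (u ++ v)
| weq_sym k u v : weq k u v -> weq k v u
| weq_trans k l u v w : weq k u v -> weq l v w -> weq (k + l) u w
| weq_leq k l u v : k <= l -> weq k u v -> weq l u v.

Lemma weq_trans_leq k l m u v w :
  weq k u v -> weq l v w -> k + l <= m -> weq m u w.
Proof. by move=> uv vw /weq_leq; apply; apply: weq_trans uv vw. Qed.

Lemma weq_ctx p q k u v : weq k u v -> weq k (p ++ u ++ q) (p ++ v ++ q).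
Proof.
elim=> {k u v} [w|u a v|u r v Rr|k u v _|k l u v w _ uv _|k l u v kl _].
- exact: weq_refl.
- by have := weq_cancel (p ++ u) a (v ++ q); rewrite -!catA.
- by have := weq_rel (p ++ u) (v ++ q) Rr; rewrite -!catA.
- exact: weq_sym.
- exact: weq_trans.
- exact: weq_leq.
Qed.

Lemma weq_catl p k u v : weq k u v -> weq k (p ++ u) (p ++ v).
Proof. by move=> /(weq_ctx p [::]); rewrite !cats0. Qed.

Lemma weq_catr q k u v : weq k u v -> weq k (u ++ q) (v ++ q).
Proof. exact: weq_ctx [::] q k u v. Qed.

Lemma weq_cat k l u v u' v' :
  weq k u v -> weq l u' v' -> weq (k + l) (u ++ u') (v ++ v').
Proof. by move=> uv uv'; apply: weq_trans (weq_catr _ uv) (weq_catl _ uv'). Qed.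

Lemma weq_free u v : freely_equal u v -> weq 0 u v.
Proof.
elim=> [u' a v'|w|w1 w2 _|w1 w2 w3 _ + _].
- exact: weq_cancel.
- exact: weq_refl.
- exact: weq_sym.
- exact: weq_trans.
Qed.

Lemma weq_mulV p w q : weq 0 (p ++ w ++ winv w ++ q) (p ++ q).
Proof. exact/weq_free/freely_equal_mulV. Qed.

Lemma weq_Vmul p w q : weq 0 (p ++ winv w ++ w ++ q) (p ++ q).
Proof. exact/weq_free/freely_equal_Vmul. Qed.

Lemma weq_cancell p k u v : weq k (p ++ u) (p ++ v) -> weq k u v.
Proof.
move=> /(weq_catl (winv p)) puv.
have /weq_trans_leq H := weq_sym (weq_Vmul [::] p u).
apply: H (weq_trans puv (weq_Vmul [::] p v)) _.
by rewrite addn0.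
Qed.

Lemma conj_prod_cat (c c' : seq (word X * word X)) :
  conj_prod (c ++ c') = conj_prod c ++ conj_prod c'.
Proof. by rewrite /conj_prod map_cat flatten_cat. Qed.

Lemma symmetrized_winv r : r \in symmetrized R -> winv r \in symmetrized R.
Proof.
rewrite !mem_cat => /orP[Rr|/mapP[s Rs ->]]; last by rewrite winvK Rs.
by rewrite (map_f _ Rr) orbT.
Qed.

Lemma winv_conj_prod (c : seq (word X * word X)) :
  winv (conj_prod c) = conj_prod (rev [seq (p.1, winv p.2) | p <- c]).
Proof.
elim: c => // p c IHc.
rewrite -cat1s conj_prod_cat winv_cat IHc map_cat rev_cat conj_prod_cat.
by rewrite /conj_prod /= !cats0 !winv_cat winvK -!catA.
Qed.

(** Deleting r from u r v contributes one conjugate of r by u; symmetry inverts a product of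
    conjugates and transitivity concatenates two. This turns a count of rewriting steps into a bound
    on area. *)
Lemma weq_conj_prod k u v :
  weq k u v -> exists2 j, j <= k & is_conj_prod R j (u ++ winv v).
Proof.
elim=> {k u v}
  [w|u a v|u r v Rr|k u v _|k l u v w _ IHuv _ IHvw|k l u v kl _].
- exists 0 => //; exists [::]; split=> //.
  by have := freely_equal_mulV [::] w [::]; rewrite cats0.
- exists 0 => //; exists [::]; split=> //.
  apply: freely_equal_trans (freely_equal_mulV [::] (u ++ v) [::]).
  rewrite /= cats0.
  apply: (freely_equal_ctx [::] (winv (u ++ v))).
  exact: freely_equal_cancel.
- exists 1 => //; exists [:: (u, r)]; split=> //.
    by move=> p; rewrite inE => /eqP->; rewrite mem_cat Rr.
  rewrite /conj_prod /= cats0 winv_cat -!catA.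
  have := freely_equal_mulV (u ++ r) v (winv u).
  by rewrite -!catA.
- move=> [j jk [c [sc Rc cE]]]; exists j => //.
  exists (rev [seq (p.1, winv p.2) | p <- c]); split.
  + by rewrite size_rev size_map.
  + move=> p; rewrite mem_rev => /mapP[q /Rc qR ->].
    exact: symmetrized_winv.
  + rewrite -winv_conj_prod -[v in v ++ _]winvK -winv_cat.
    exact: freely_equal_winv.
- have [i ik [c [sc Rc cE]]] := IHuv.
  have [j jl [d [sd Rd dE]]] := IHvw.
  exists (i + j); first exact: leq_add.
  exists (c ++ d); split.
  + by rewrite size_cat sc sd.
  + by move=> p; rewrite mem_cat => /orP[/Rc|/Rd].
  rewrite conj_prod_cat.
  have := freely_equal_Vmul u v (winv w) => /freely_equal_sym.
  move/freely_equal_trans; apply.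
  apply: (@freely_equal_trans _ _ (conj_prod c ++ (v ++ winv w))).
    by rewrite catA; apply: (freely_equal_ctx [::]).
  by have := freely_equal_ctx (conj_prod c) [::] dE; rewrite !cats0.
- by move=> [j jk cj]; exists j => //; apply: leq_trans kl.
Qed.

Lemma conj_prod_weq k w : is_conj_prod R k w -> weq k w [::].
Proof.
move=> [c [<- Rc /weq_free wE]].
suff {wE} cE : weq (size c) (conj_prod c) [::].
  exact: weq_trans_leq wE cE _.
elim: c Rc {w} => [|[u r] c IHc] Rc; first exact: weq_refl.
rewrite -cat1s conj_prod_cat size_cat.
apply: (weq_cat (v := [::]) (v' := [::])); last first.
  by apply: IHc => p cp; apply: Rc; rewrite inE cp orbT.
have ucancel : weq 0 (u ++ winv u) [::].
  by have := weq_mulV [::] u [::]; rewrite cats0.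
have := Rc (u, r) (mem_head _ _); rewrite /conj_prod /= cats0 mem_cat.
move=> /orP[Rr|/mapP[s Rs ->]].
  exact: weq_trans (weq_rel _ _ Rr) ucancel.
rewrite catA.
apply: (weq_trans (l := 0) (weq_sym (weq_rel (u ++ winv s) (winv u) Rs))).
apply: (weq_trans (k := 0) (l := 0) _ ucancel).
by rewrite -catA; apply: weq_Vmul.
Qed.

Lemma area_weq k w : weq k w [::] -> area R w <= k.
Proof.
move=> /weq_conj_prod[j jk]; rewrite cats0 => wj.
exact: leq_trans (least_le wj) jk.
Qed.

Definition subst_letter (theta : X -> word X) (a : letter X) : word X :=
  if a.2 then winv (theta a.1) else theta a.1.

Definition subst (theta : X -> word X) (w : word X) : word X :=
  flatten (map (subst_letter theta) w).

Lemma subst_cat theta u v : subst theta (u ++ v) = subst theta u ++ subst theta v.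
Proof. by rewrite /subst map_cat flatten_cat. Qed.

Lemma subst1 theta (a : letter X) : subst theta [:: a] = subst_letter theta a.
Proof. exact: cats0. Qed.

Lemma subst_letter_linv theta (a : letter X) :
  subst_letter theta (linv a) = winv (subst_letter theta a).
Proof. by case: a => x []; rewrite /subst_letter /= ?winvK. Qed.

Lemma size_subst theta K w :
  (forall x, size (theta x) <= K) -> size (subst theta w) <= K * size w.
Proof.
move=> thK; elim: w => [|[x b] w IHw]; first by rewrite muln0.
rewrite -cat1s subst_cat subst1 size_cat [size (_ ++ w)]/= mulnS leq_add //.
by rewrite /subst_letter; case: b => /=; rewrite ?size_winv; apply: thK.
Qed.

Lemma weq_subst theta K k u v :
    (forall r, r \in R -> weq K (subst theta r) [::]) ->
  weq k u v -> weq (K * k) (subst theta u) (subst theta v).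
Proof.
move=> thK; elim=> {k u v}
  [w|u a v|u r v Rr|k u v _|k l u v w _ uv _ vw|k l u v kl _].
- rewrite muln0; exact: weq_refl.
- rewrite muln0 subst_cat -cat1s -(cat1s (linv a)) !subst_cat.
  rewrite !subst1 subst_letter_linv; exact: weq_mulV.
- rewrite muln1 !subst_cat.
  exact: (weq_ctx (subst theta u) (subst theta v) (thK r Rr)).
- exact: weq_sym.
- rewrite mulnDr; exact: weq_trans uv vw.
- by apply: weq_leq; rewrite leq_mul2l kl orbT.
Qed.

(** [F] and [H] are word morphisms that differ on letters by conjugation by [c]. Moving [c] across
    [w] one letter at a time costs [K] per letter. *)
Lemma weq_morph_conj (F H : word X -> word X) K c w :
    (forall u v, F (u ++ v) = F u ++ F v) -> (forall u v, H (u ++ v) = H u ++ H v) ->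
    F [::] = [::] -> H [::] = [::] ->
    (forall a : letter X, weq K (F [:: a] ++ c) (c ++ H [:: a])) ->
  weq (K * size w) (F w ++ c) (c ++ H w).
Proof.
move=> Fcat Hcat F0 H0 conjK; elim: w => [|a w IHw].
  by rewrite muln0 F0 H0 cats0; apply: weq_refl.
rewrite -cat1s Fcat Hcat size_cat mulnDr addnC -catA.
apply: weq_trans (weq_catl (F [:: a]) IHw) _.
by rewrite catA [X in weq _ _ X]catA muln1; apply: weq_catr (conjK a).
Qed.

End Rewriting.

(** * Pushing paths into the kernel *)

Section Eval.
Variables (H : groupType) (X : finType) (f : X -> H).
Implicit Types (u v w : word X).

Lemma eval1 (a : letter X) : eval f [:: a] = eval_letter f a.
Proof. by rewrite /eval big_seq1. Qed.

Lemma eval_nil : eval f [::] = 1%g.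
Proof. by rewrite /eval big_nil. Qed.

Lemma eval_cat u v : eval f (u ++ v) = (eval f u * eval f v)%g.
Proof. by rewrite /eval big_cat. Qed.

Lemma eval_letter_linv (a : letter X) : eval_letter f (linv a) = (eval_letter f a)^-1%g.
Proof. by case: a => x []; rewrite /eval_letter /= ?invgK. Qed.

Lemma eval_winv w : eval f (winv w) = (eval f w)^-1%g.
Proof.
elim: w => [|a w IHw]; first by rewrite eval_nil invg1.
by rewrite winv_cons -(cat1s a) !eval_cat IHw !eval1 eval_letter_linv invgM.
Qed.

End Eval.

(** The solution of a(0) = K, a(j+1) = 3 K a(j). It bounds both lengths and areas after [j] pushing
    steps; the factor 3 leaves room for three terms of size at most [K * growth K j]. *)
Definition growth (K j : nat) : nat := K * (3 * K) ^ j.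

Lemma growthS K j : growth K j.+1 = 3 * K * growth K j.
Proof. by rewrite /growth expnS; lia. Qed.

Lemma growth_gt0 K j : 0 < K -> 0 < growth K j.
Proof. by move=> K0; rewrite muln_gt0 K0 expn_gt0 muln_gt0 K0. Qed.

Section Push.
Variables (G : groupType) (V : zmodType) (phi : G -> V).
Hypothesis phiM : forall x y, phi (x * y)%g = (phi x + phi y)%R.
Variables (Y : finType) (R : seq (word Y)) (f : Y -> G).
Hypothesis phi_f : forall w, phi (eval f w) = 0%R.
Hypothesis f_onto : forall g, phi g = 0%R -> exists w, eval f w = g.
Hypothesis f_ker : forall w, eval f w = 1%g -> exists k, is_conj_prod R k w.
Hypothesis f_rel : forall r, r \in R -> eval f r = 1%g.

Definition cost (u v : word Y) : nat := least (fun k => weq R k u v).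

Lemma weq_cost u v : eval f u = eval f v -> weq R (cost u v) u v.
Proof.
move=> uv; apply: (@leastP (fun k => weq R k u v)).
have [|k /conj_prod_weq uVv] := f_ker (w := u ++ winv v).
  by rewrite eval_cat eval_winv uv mulgV.
exists k; apply: weq_trans_leq _ (weq_catr v uVv) (leqnn (0 + k)).
by rewrite -catA; have := weq_sym (weq_Vmul R u v [::]); rewrite !cats0.
Qed.

Definition im (v : V) : Prop := exists g, phi g = v.

Lemma phi1 : phi 1%g = 0%R.
Proof. by apply: (addrI (phi 1%g)); rewrite -phiM mulg1 addr0. Qed.

Lemma phiV x : phi x^-1%g = (- phi x)%R.
Proof. by apply: (addrI (phi x)); rewrite -phiM mulgV phi1 subrr. Qed.

Lemma im0 : im 0%R.
Proof. by exists 1%g; rewrite phi1. Qed.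

Lemma imD u v : im u -> im v -> im (u + v)%R.
Proof. by move=> [x <-] [y <-]; exists (x * y)%g; rewrite phiM. Qed.

Lemma imB u v : im u -> im v -> im (u - v)%R.
Proof. by move=> [x <-] [y <-]; exists (x * y^-1)%g; rewrite phiM phiV. Qed.

Definition rep (g : G) : word Y := xget [::] [set w | eval f w = g]%classic.

Lemma repP g : phi g = 0%R -> eval f (rep g) = g.
Proof. by move=> /f_onto; exact: (@xgetPex _ _ [set w | eval f w = g]%classic). Qed.

(** A set-theoretic section of [phi] over its image. The normalisation at 0 makes all twisting
    trivial once a path has reached the kernel. *)
Definition lift (v : V) : G :=
  if v == 0%R then 1%g else xget 1%g [set g | phi g = v]%classic.

Lemma liftP v : im v -> phi (lift v) = v.
Proof.
rewrite /lift; case: eqP => [->|_]; first by rewrite phi1.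
exact: (@xgetPex _ _ [set g | phi g = v]%classic).
Qed.

Lemma lift0 : lift 0%R = 1%g.
Proof. by rewrite /lift eqxx. Qed.

(** Conjugation by [lift d] preserves the kernel; [subst (theta d)] realises it on words. *)
Definition theta (d : V) (y : Y) : word Y := rep (lift d * f y * (lift d)^-1)%g.

Lemma eval_theta d w :
  eval f (subst (theta d) w) = (lift d * eval f w * (lift d)^-1)%g.
Proof.
have theta1 y : eval f (theta d y) = (lift d * f y * (lift d)^-1)%g.
  rewrite repP // !phiM phiV.
  by have := phi_f [:: (y, false)]; rewrite eval1 => ->; rewrite addr0 subrr.
elim: w => [|[y b] w IHw]; first by rewrite eval_nil mulg1 mulgV.
rewrite -cat1s subst_cat subst1 !eval_cat IHw eval1.
rewrite /subst_letter /eval_letter /=.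
by case: b; rewrite ?eval_winv theta1 ?invgM ?invgK !mulgA mulgVK.
Qed.

(** A word for the kernel element c with [lift d * lift e] = c [* lift (d + e - d') * lift d'],
    needed when the ends of an edge lying over [e] are moved by [d] and [d']. For [d' = 0] it is the
    factor set of the extension. *)
Definition corr (d e d' : V) : word Y :=
  rep (lift d * lift e * (lift d')^-1 * (lift (d + e - d'))^-1)%g.

Lemma eval_corr d e d' : im d -> im e -> im d' ->
  eval f (corr d e d') =
    (lift d * lift e * (lift d')^-1 * (lift (d + e - d'))^-1)%g.
Proof.
move=> imd ime imd'; rewrite repP // !phiM !phiV !liftP ?subrr //.
by apply: imB => //; apply: imD.
Qed.

(** The kernel part of an edge: [E] is [base E] followed by [lift (phi E)]. *)
Definition base (E : G) : word Y := rep (E * (lift (phi E))^-1)%g.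

Lemma eval_base E : eval f (base E) = (E * (lift (phi E))^-1)%g.
Proof. by rewrite repP // phiM phiV liftP ?subrr //; exists E. Qed.

Variables (D : seq V) (S : seq G).
Hypothesis imD_ : forall d, d \in D -> im d.
Hypothesis D0 : 0%R \in D.

(** One constant for everything that a single pushing step uses. [theta_corr] compares the two
    double conjugations that [corr] relates, [corr_corr] is the cocycle identity for two consecutive
    edges, and [base_mul] fills a triangle before any pushing. *)
Record push_bound (K : nat) : Prop := PushBound {
  push_bound_gt0 : 0 < K;
  size_theta : forall d y, d \in D -> size (theta d y) <= K;
  size_corr : forall d e d', d \in D -> e \in D -> d' \in D ->
    size (corr d e d') <= K;
  size_base : forall E, E \in S -> size (base E) <= K;
  theta_rel : forall d r, d \in D -> r \in R ->
    weq R K (subst (theta d) r) [::];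
  theta_corr : forall d e d' (a : letter Y), d \in D -> e \in D -> d' \in D ->
    weq R K (subst (theta d) (subst (theta e) [:: a]) ++ corr d e d')
      (corr d e d' ++ subst (theta (d + e - d')) (subst (theta d') [:: a]));
  corr_corr : forall d e d' e' d'',
    d \in D -> e \in D -> d' \in D -> e' \in D -> d'' \in D ->
    weq R K (corr d e d' ++ subst (theta (d + e - d')) (corr d' e' d'') ++
               corr (d + e - d') (d' + e' - d'') 0)
      (subst (theta d) (corr e e' 0) ++ corr d (e + e') d'');
  base_mul : forall E E', E \in S -> E' \in S ->
    weq R K (base E ++ subst (theta (phi E)) (base E') ++
               corr (phi E) (phi E') 0)
      (base (E * E')%g);
  theta0 : forall a : letter Y, weq R K (subst (theta 0) [:: a]) [:: a];
  corr0 : weq R K (corr 0 0 0) [::];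
  base_letter : forall a : letter Y, weq R K (base (eval f [:: a])) [:: a] }.

Lemma leq_max_seq (T : eqType) (s : seq T) (F : T -> nat) x :
  x \in s -> F x <= \max_(y <- s) F y.
Proof. by move=> xs; apply: leq_bigmax_seq. Qed.

(** The two sides of each relation have the same value in [G], so they are linked by finitely many
    relator applications. As [D], [S], [R] and the alphabet are finite, each family of costs has a
    maximum, and the sum of these maxima serves as [K]. *)
Lemma push_bound_exists : exists K, push_bound K.
Proof.
have max3 (F : V -> V -> V -> nat) : exists K, forall d e d',
    d \in D -> e \in D -> d' \in D -> F d e d' <= K.
  exists (\max_(d <- D) \max_(e <- D) \max_(d' <- D) F d e d') => d e d' dD eD d'D.
  apply: leq_trans (leq_max_seq (fun d => \max_(e <- D) \max_(d' <- D) F d e d') dD).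
  apply: leq_trans (leq_max_seq (fun e => \max_(d' <- D) F d e d') eD).
  exact: (leq_max_seq (F d e)).
have max_letter (F : letter Y -> nat) : exists K, forall a, F a <= K.
  by exists (\max_a F a) => a; apply: leq_bigmax.
have [K1 K1P] : exists K, forall d, d \in D -> forall y, size (theta d y) <= K.
  exists (\max_(d <- D) \max_y size (theta d y)) => d dD y.
  apply: leq_trans (leq_max_seq (fun d => \max_y size (theta d y)) dD).
  exact: leq_bigmax.
have [K2 K2P] := max3 (fun d e d' => size (corr d e d')).
pose K3 := \max_(E <- S) size (base E).
have [K4 K4P] : exists K, forall d r, d \in D -> r \in R ->
    weq R K (subst (theta d) r) [::].
  exists (\max_(d <- D) \max_(r <- R) cost (subst (theta d) r) [::]) => d r dD Rr.
  have H : eval f (subst (theta d) r) = eval f [::].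
    by rewrite eval_theta f_rel // eval_nil mulg1 mulgV.
  apply: weq_leq (weq_cost H).
  apply: leq_trans
    (leq_max_seq (fun d => \max_(r <- R) cost (subst (theta d) r) [::]) dD).
  exact: (leq_max_seq (fun r => cost (subst (theta d) r) [::])).
pose F5 d e d' (a : letter Y) :=
  cost (subst (theta d) (subst (theta e) [:: a]) ++ corr d e d')
    (corr d e d' ++ subst (theta (d + e - d')) (subst (theta d') [:: a])).
have [K5 K5P] : exists K, forall d e d' a,
    d \in D -> e \in D -> d' \in D -> F5 d e d' a <= K.
  have [K KP] := max3 (fun d e d' => \max_a F5 d e d' a).
  exists K => d e d' a dD eD d'D; apply: leq_trans (KP _ _ _ dD eD d'D).
  exact: (leq_bigmax (F := F5 d e d')).
pose F6 d e d' e' d'' :=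
  cost (corr d e d' ++ subst (theta (d + e - d')) (corr d' e' d'') ++
          corr (d + e - d') (d' + e' - d'') 0)
    (subst (theta d) (corr e e' 0) ++ corr d (e + e') d'').
have [K6 K6P] : exists K, forall d e d' e' d'',
    d \in D -> e \in D -> d' \in D -> e' \in D -> d'' \in D ->
    F6 d e d' e' d'' <= K.
  have [K KP] :=
    max3 (fun d e d' => \max_(e' <- D) \max_(d'' <- D) F6 d e d' e' d'').
  exists K => d e d' e' d'' dD eD d'D e'D d''D.
  apply: leq_trans (KP _ _ _ dD eD d'D).
  apply: leq_trans (leq_max_seq (fun e' => \max_(d'' <- D) F6 d e d' e' d'') e'D).
  exact: (leq_max_seq (F6 d e d' e')).
pose F7 E E' :=
  cost (base E ++ subst (theta (phi E)) (base E') ++ corr (phi E) (phi E') 0)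
    (base (E * E')%g).
have [K7 K7P] : exists K, forall E E', E \in S -> E' \in S -> F7 E E' <= K.
  exists (\max_(E <- S) \max_(E' <- S) F7 E E') => E E' ES E'S.
  apply: leq_trans (leq_max_seq (fun E => \max_(E' <- S) F7 E E') ES).
  exact: (leq_max_seq (F7 E)).
have [K8 K8P] := max_letter (fun a => cost (subst (theta 0) [:: a]) [:: a]).
have [K9 K9P] := max_letter (fun a => cost (base (eval f [:: a])) [:: a]).
have imP : forall d, d \in D -> im d := imD_.
exists (1 + K1 + K2 + K3 + K4 + K5 + K6 + K7 + K8 + K9 + cost (corr 0 0 0) [::]).
split=> //.
- by move=> d y /K1P/(_ y); lia.
- by move=> d e d' dD eD d'D; have := K2P _ _ _ dD eD d'D; lia.
- by move=> E /(leq_max_seq (fun E => size (base E))); rewrite -/K3; lia.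
- by move=> d r dD Rr; apply: weq_leq (K4P _ _ dD Rr); lia.
- move=> d e d' a dD eD d'D.
  have H : eval f (subst (theta d) (subst (theta e) [:: a]) ++ corr d e d') =
    eval f (corr d e d' ++ subst (theta (d + e - d')) (subst (theta d') [:: a])).
    rewrite !eval_cat !eval_theta eval_corr; [|exact: imP..].
    by rewrite !mulgA !mulgVK.
  apply: weq_leq (weq_cost H).
  by apply: leq_trans (K5P _ _ _ a dD eD d'D) _; lia.
- move=> d e d' e' d'' dD eD d'D e'D d''D.
  have H : eval f (corr d e d' ++ subst (theta (d + e - d')) (corr d' e' d'') ++
      corr (d + e - d') (d' + e' - d'') 0) =
    eval f (subst (theta d) (corr e e' 0) ++ corr d (e + e') d'').
    rewrite !eval_cat !eval_theta !eval_corr;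
      try (by do ?[exact: im0 | exact: imP | apply: imB | apply: imD]).
    rewrite lift0 invg1 !mulg1 !subr0 !mulgA !mulgVK.
    by congr (_ * (lift _)^-1)%g; rewrite !addrA addrNK.
  apply: weq_leq (weq_cost H).
  by apply: leq_trans (K6P _ _ _ _ _ dD eD d'D e'D d''D) _; lia.
- move=> E E' ES E'S.
  have H : eval f (base E ++ subst (theta (phi E)) (base E') ++
      corr (phi E) (phi E') 0) = eval f (base (E * E')%g).
    rewrite !eval_cat eval_theta eval_corr;
      [|by exists E|by exists E'|exact: im0].
    by rewrite !eval_base lift0 invg1 mulg1 subr0 phiM !mulgA !mulgVK.
  apply: weq_leq (weq_cost H).
  by apply: leq_trans (K7P _ _ ES E'S) _; lia.
- move=> a.
  have H : eval f (subst (theta 0) [:: a]) = eval f [:: a].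
    by rewrite eval_theta lift0 mul1g invg1 mulg1.
  by apply: weq_leq (weq_cost H); apply: leq_trans (K8P a) _; lia.
- have H : eval f (corr 0 0 0) = eval f [::].
    rewrite eval_corr; [|exact: im0..].
    by rewrite addr0 subr0 eval_nil lift0 invg1 !mulg1.
  by apply: weq_leq (weq_cost H); lia.
- move=> a.
  have H : eval f (base (eval f [:: a])) = eval f [:: a].
    by rewrite eval_base phi_f lift0 invg1 mulg1.
  by apply: weq_leq (weq_cost H); apply: leq_trans (K9P a) _; lia.
Qed.

(* The vertices of an edge [E] of the Cayley graph of [G] are moved towards the
   kernel along paths whose images in [V] are [a] and [b]. After [j] steps the
   edge is the product of [push a b E j] and the lift of [b j - a j]. *)
Fixpoint push (a b : nat -> V) (E : G) (j : nat) : word Y :=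
  if j is i.+1 then
    subst (theta (a i - a i.+1)) (push a b E i) ++
      corr (a i - a i.+1) (b i - a i) (b i - b i.+1)
  else base E.

Definition steps_in (a : nat -> V) : Prop := forall j, (a j - a j.+1)%R \in D.

Definition close (a b : nat -> V) : Prop := forall j, (b j - a j)%R \in D.

Section Bounds.
Variable K : nat.
Hypothesis KP : push_bound K.

Let K_gt0 : 0 < K. Proof. exact: push_bound_gt0 KP. Qed.

Lemma size_push a b E j : steps_in a -> steps_in b -> close a b -> E \in S ->
  size (push a b E j) <= growth K j.
Proof.
move=> sa sb ab ES; elim: j => [|j IHj].
  by rewrite /growth muln1; apply: size_base.
rewrite growthS /= size_cat.
have := size_subst (push a b E j) (fun y => size_theta KP y (sa j)).
have := size_corr KP (sa j) (ab j) (sb j).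
have := growth_gt0 j K_gt0.
by nia.
Qed.

(** The second edge is conjugated by the lift of [b j - a j], and the final [corr] merges the two
    lifts into one. In the induction, [H1] moves a correction across the second edge, [H2] is the
    cocycle identity, and [H3] applies the conjugation by [d] to the previous stage. *)
Lemma push_triangle a b e E E' j :
    steps_in a -> steps_in b -> steps_in e ->
    close a b -> close b e -> close a e ->
    E \in S -> E' \in S -> phi E = (b 0 - a 0)%R -> phi E' = (e 0 - b 0)%R ->
  weq R (growth K j)
    (push a b E j ++ subst (theta (b j - a j)) (push b e E' j) ++
       corr (b j - a j) (e j - b j) 0)
    (push a e (E * E')%g j).
Proof.
move=> sa sb se ab be ae ES E'S phiE phiE'.
elim: j => [|j IHj].
  rewrite /growth muln1 -phiE -phiE'; exact: base_mul.
have szn := size_push j sb se be E'S.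
rewrite growthS /=.
move: (sa j) (sb j) (se j) (ab j) (be j) IHj szn.
(* The offset after the step is put in the form d + g - d', so that the relations of [push_bound]
   apply literally. *)
have moveE (x x' y y' : V) : (y' - x' = (x - x') + (y - x) - (y - y'))%R.
  by rewrite (addrC (x - x')%R) subrKA opprB [RHS]addrC subrKA.
rewrite (moveE (a j) (a j.+1) (b j) (b j.+1)) (moveE (b j) (b j.+1) (e j) (e j.+1)).
have -> : (e j - a j = (b j - a j) + (e j - b j))%R.
  by rewrite [RHS]addrC subrKA.
move: (push a b E j) (push b e E' j) (push a e (E * E')%g j) => n1 n2 n3.
set d := (a j - a j.+1)%R; set d' := (b j - b j.+1)%R.
set d'' := (e j - e j.+1)%R; set g := (b j - a j)%R.
set g' := (e j - b j)%R => dD d'D d''D gD g'D IHj szn.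
rewrite subst_cat.
have H1 : weq R (K * size n2)
    (corr d g d' ++ subst (theta (d + g - d')) (subst (theta d') n2))
    (subst (theta d) (subst (theta g) n2) ++ corr d g d').
  apply: weq_sym; apply: (weq_morph_conj
    (F := fun w => subst (theta d) (subst (theta g) w))
    (H := fun w => subst (theta (d + g - d')) (subst (theta d') w))) => //.
  - by move=> u v; cbv beta; rewrite !subst_cat.
  - by move=> u v; cbv beta; rewrite !subst_cat.
  - by move=> c; apply: theta_corr.
have H2 := corr_corr KP dD gD d'D g'D d''D.
have H3 := weq_subst (fun r Rr => theta_rel KP dD Rr) IHj.
rewrite !subst_cat in H3.
have C1 := weq_ctx (subst (theta d) n1)
  (subst (theta (d + g - d')) (corr d' g' d'') ++
     corr (d + g - d') (d' + g' - d'') 0) H1.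
have C2 := weq_catl (subst (theta d) n1 ++ subst (theta d) (subst (theta g) n2)) H2.
have C3 := weq_catr (corr d (g + g') d'') H3.
rewrite -!catA in C1 C2 C3 *.
apply: weq_trans_leq C1 (weq_trans C2 C3) _.
have := growth_gt0 j K_gt0.
by nia.
Qed.

(** At the end of the paths the offsets vanish, so the twist in [push_triangle] becomes [theta 0]
    and the last factor [corr 0 0 0]. Removing them costs [K] per letter of the second edge and [K]
    more, whence one further factor of growth. *)
Lemma push_mul a b e E E' h :
    steps_in a -> steps_in b -> steps_in e ->
    close a b -> close b e -> close a e ->
    E \in S -> E' \in S -> phi E = (b 0 - a 0)%R -> phi E' = (e 0 - b 0)%R ->
    a h = 0%R -> b h = 0%R -> e h = 0%R ->
  weq R (growth K h.+1) (push a b E h ++ push b e E' h) (push a e (E * E')%g h).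
Proof.
move=> sa sb se ab be ae ES E'S phiE phiE' ah bh eh.
have := push_triangle h sa sb se ab be ae ES E'S phiE phiE'.
have := size_push h sb se be E'S.
rewrite ah bh eh subr0.
move: (push a b E h) (push b e E' h) (push a e _ h) => n1 n2 n3 szn H.
have H0 : weq R (K * size n2) (subst (theta 0) n2 ++ [::]) ([::] ++ n2).
  apply: (weq_morph_conj (H := id)) => // [u v|c]; first exact: subst_cat.
  rewrite cats0; exact: theta0.
have := weq_sym (weq_catl n1 (weq_cat H0 (corr0 KP))).
rewrite !cats0 => H1; apply: weq_trans_leq H1 H _.
rewrite growthS; have := growth_gt0 h K_gt0.
by nia.
Qed.

(** An edge of the kernel stays put: each step only applies [theta 0] and appends [corr 0 0 0], both
    trivial at bounded cost. *)
Lemma push_const (c : letter Y) h :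
  eval f [:: c] \in S ->
  weq R (growth K h) (push (fun=> 0%R) (fun=> 0%R) (eval f [:: c]) h) [:: c].
Proof.
move=> cS; have s0 : steps_in (fun=> 0%R) by move=> j; rewrite subr0.
elim: h => [|h IHh]; first by rewrite /growth muln1; apply: base_letter.
rewrite growthS /= subr0.
have := size_push h s0 s0 s0 cS.
move: (push _ _ _ h) IHh => n IHn szn.
have H0 : weq R (K * size n) (subst (theta 0) n ++ [::]) ([::] ++ n).
  apply: (weq_morph_conj (H := id)) => // [u v|x]; first exact: subst_cat.
  rewrite cats0; exact: theta0.
rewrite cats0 in H0.
have := weq_cat H0 (corr0 KP); rewrite !cats0 => H1.
apply: weq_trans_leq H1 IHn _.
have := growth_gt0 h K_gt0.
by nia.
Qed.

End Bounds.
End Push.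

(** * Lipschitz coordinates on finitely generated abelian groups *)

Section Coordinates.
Variable V : zmodType.
Implicit Types (t v x : V) (ts : seq V) (z : nat -> int).

(** Coefficients form an infinite sequence, of which only the first [size ts] terms matter; this
    makes passing to the tail a mere shift. *)
Fixpoint comb ts z : V :=
  if ts is t :: ts' then (t *~ z 0%N + comb ts' (fun i => z i.+1))%R else 0%R.

Definition span ts v : Prop := exists z, comb ts z = v.

Lemma eq_comb ts z z' : z =1 z' -> comb ts z = comb ts z'.
Proof. by move=> zz'; congr comb; apply: funext. Qed.

Lemma comb0 ts : comb ts (fun=> 0%R) = 0%R.
Proof. by elim: ts => //= t ts ->; rewrite mulr0z addr0. Qed.

Lemma combB ts z z' :
  comb ts (fun i => z i - z' i)%R = (comb ts z - comb ts z')%R.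
Proof.
elim: ts z z' => [|t ts IHts] z z' /=; first by rewrite subr0.
by rewrite (IHts (fun i => z i.+1) (fun i => z' i.+1)) mulrzBr opprD addrACA.
Qed.

Lemma spanB ts u v : span ts u -> span ts v -> span ts (u - v)%R.
Proof. by move=> [z <-] [z' <-]; rewrite -combB; eexists. Qed.

Lemma span0 ts : span ts 0%R.
Proof. by exists (fun=> 0%R); apply: comb0. Qed.

Lemma spanN ts v : span ts v -> span ts (- v)%R.
Proof. by move=> /(spanB (span0 ts)); rewrite sub0r. Qed.

Lemma spanD ts u v : span ts u -> span ts v -> span ts (u + v)%R.
Proof. by move=> su /spanN sv; rewrite -[v]opprK; apply: spanB. Qed.

Lemma spanMz ts v (n : int) : span ts v -> span ts (v *~ n)%R.
Proof.
have spanMn u k : span ts u -> span ts (u *+ k)%R.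
  by move=> su; elim: k => [|k IHk]; [exact: span0 | rewrite mulrS; apply: spanD].
by case: n => n sv; [exact: spanMn | apply: spanN; apply: spanMn].
Qed.

Lemma mem_span ts v : v \in ts -> span ts v.
Proof.
elim: ts => // t ts IHts; rewrite inE => /predU1P[->|/IHts[z <-]].
  exists (fun i => if i is 0 then 1%R else 0%R).
  by rewrite /= mulr1z comb0 addr0.
by exists (fun i => if i is j.+1 then z j else 0%R); rewrite /= mulr0z add0r.
Qed.

Lemma comb_bounded_finite ts (B : nat) :
  exists D : seq V, forall z, (forall i, absz (z i) <= B) -> comb ts z \in D.
Proof.
elim: ts => [|t ts [D DP]]; first by exists [:: 0%R] => z _; rewrite inE.
exists [seq (t *~ (i%:Z - B%:Z) + d)%R | i <- iota 0 (2 * B + 1), d <- D] => z zB.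
have -> : comb (t :: ts) z =
    (t *~ ((absz (z 0%N + B%:Z)%R)%:Z - B%:Z) + comb ts (fun i => z i.+1))%R.
  by congr (t *~ _ + _)%R; have := zB 0%N; lia.
apply: (allpairs_f (fun (i : nat) d => (t *~ (i%:Z - B%:Z) + d)%R)).
  by rewrite mem_iota; have := zB 0%N; lia.
by apply: DP.
Qed.

(** The exponent of [t] modulo the span of [ts]. If some positive multiple m t lies in that span,
    the exponent can be chosen in [0, m], so it varies by at most m. Otherwise it is unique, hence
    additive, and adding [x] shifts it by a fixed amount. *)
Lemma coset_exponent t ts : exists c : V -> int,
  [/\ forall v, span (t :: ts) v -> span ts (v - t *~ c v)%R, c 0%R = 0%R
    & forall x, span (t :: ts) x -> exists B : nat,
        forall v, span (t :: ts) v -> absz (c (v + x) - c v)%R <= B].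
Proof.
have exP v : span (t :: ts) v -> exists c : int, span ts (v - t *~ c)%R.
  by move=> [z <-]; exists (z 0%N); rewrite /= addrC addKr; eexists.
have [[m [m0 spm]]|no_power] := pselect (exists m, 0 < m /\ span ts (t *+ m)%R).
  have exP' v : span (t :: ts) v -> exists c : int,
      span ts (v - t *~ c)%R /\ (0 <= c <= m%:Z)%R.
    move=> /exP[c sc]; exists (c %% m%:Z)%Z; split; last first.
      by have := modz_ge0 c (_ : m%:Z != 0)%R; have := ltz_pmod c (_ : 0 < m%:Z)%R; lia.
    have -> : (v - t *~ (c %% m%:Z)%Z =
               (v - t *~ c) + (t *+ m) *~ (c %/ m%:Z)%Z)%R.
      have cE : (t *~ c = (t *+ m) *~ (c %/ m%:Z)%Z + t *~ (c %% m%:Z)%Z)%R.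
        by rewrite {1}(divz_eq c m%:Z) mulrzDr mulrC mulrzA.
      by rewrite cE opprD [(- _ - _)%R]addrC addrA subrK.
    by apply: spanD => //; apply: spanMz.
  (* The value at 0 is imposed, since an arbitrary choice in [0, m] could return m there. *)
  pose c v := if v == 0%R then 0%R else
    xget 0%R [set c : int | span ts (v - t *~ c)%R /\ (0 <= c <= m%:Z)%R]%classic.
  have cP v : span (t :: ts) v -> span ts (v - t *~ c v)%R /\ (0 <= c v <= m%:Z)%R.
    rewrite /c; case: eqP => [->|_] sv.
      by rewrite mulr0z subr0; split=> //; exact: span0.
    exact: (@xgetPex _ _ [set c : int |
      span ts (v - t *~ c)%R /\ (0 <= c <= m%:Z)%R]%classic (exP' v sv)).
  exists c; split; first by move=> v /cP[].
    by rewrite /c eqxx.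
  move=> x sx; exists m => v sv.
  by have [_ +] := cP v sv; have [_ +] := cP _ (spanD sv sx); lia.
have uniq_exp v c c' : span ts (v - t *~ c)%R -> span ts (v - t *~ c')%R -> c = c'.
  move=> sc sc'; apply/eqP; rewrite -subr_eq0; apply/negPn/negP => cc'.
  apply: no_power; exists (absz (c - c')%R); split; first by lia.
  have : span ts (t *~ (c - c'))%R.
    rewrite mulrzBr; have := spanB sc' sc.
    by rewrite opprB addrC addrA subrK.
  case: (c - c')%R => n; first by [].
  by move=> /spanN; rewrite opprK.
pose c v := xget 0%R [set c : int | span ts (v - t *~ c)%R]%classic.
have cP v : span (t :: ts) v -> span ts (v - t *~ c v)%R.
  by move=> /exP/(@xgetPex _ 0%R [set c : int | span ts (v - t *~ c)%R]%classic).
exists c; split=> //.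
  apply: (uniq_exp 0%R); first by apply: cP; exact: span0.
  by rewrite mulr0z subr0; exact: span0.
move=> x sx; have [e se] := exP x sx; exists (absz e) => v sv.
suff -> : c (v + x)%R = (c v + e)%R by lia.
apply: (uniq_exp (v + x)%R); first by apply: cP; apply: spanD.
by rewrite mulrzDr opprD addrACA; apply: spanD => //; apply: cP.
Qed.

(** The first coordinate is the exponent of [t], the others are those of the remainder. Adding [x]
    to [v] adds x - t e to the remainder, where e takes finitely many values by [coset_exponent];
    the induction hypothesis gives a constant for each, and [uniform_bound] merges them. *)
Lemma lipschitz_coordinates ts : exists lambda : V -> nat -> int,
  [/\ forall v, span ts v -> comb ts (lambda v) = v,
      forall i, lambda 0%R i = 0%R
    & forall x, span ts x -> exists C : nat, forall v, span ts v ->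
        forall i, absz (lambda (v + x) i - lambda v i)%R <= C].
Proof.
elim: ts => [|t ts [lam [lamP lam0 lamL]]].
  exists (fun _ _ => 0%R); split=> //; first by move=> v [z].
  by move=> x _; exists 0%N.
have [c [cP c0 cL]] := coset_exponent t ts.
exists (fun v i => if i is j.+1 then lam (v - t *~ c v)%R j else c v); split.
- by move=> v sv /=; rewrite (@lamP (v - t *~ c v)%R (cP v sv)) addrC subrK.
- by case=> [|i] //; rewrite c0 mulr0z subr0.
move=> x sx; have [B BP] := cL x sx.
have [C CP] : exists C, forall e, e \in [seq (i%:Z - B%:Z)%R | i <- iota 0 (2 * B + 1)] ->
    span ts (x - t *~ e)%R -> forall v, span ts v ->
    forall i, absz (lam (v + (x - t *~ e)) i - lam v i)%R <= C.
  apply: (@uniform_bound _ _ (fun e C => span ts (x - t *~ e)%R -> forall v, span ts v ->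
    forall i, absz (lam (v + (x - t *~ e)) i - lam v i)%R <= C)).
    by move=> e k l kl H se v sv i; apply: leq_trans kl; apply: H.
  move=> e _; have [se|nse] := pselect (span ts (x - t *~ e)%R); last by exists 0%N.
  by have [C CP] := lamL _ se; exists C.
exists (maxn B C) => v sv [|i]; first by rewrite leq_max BP.
rewrite leq_max; apply/orP; right.
set e := (c (v + x) - c v)%R.
have wE : (v + x - t *~ c (v + x) = (v - t *~ c v) + (x - t *~ e))%R.
  have -> : (c (v + x) = c v + e)%R by rewrite /e [RHS]addrC subrK.
  by rewrite mulrzDr opprD addrACA.
rewrite wE; apply: CP; last exact: cP.
- apply/mapP; exists (absz (e + B%:Z)%R); last by have := BP v sv; lia.
  by rewrite mem_iota; have := BP v sv; lia.
- have := spanB (cP _ (spanD sv sx)) (cP _ sv).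
  by rewrite wE addrAC subrr add0r.
Qed.

End Coordinates.

Definition clamp (k : nat) (z : int) : int :=
  (Num.max (- k%:Z) (Num.min k%:Z z))%R.

Lemma clamp_lipschitz k x y : absz (clamp k x - clamp k y)%R <= absz (x - y)%R.
Proof. rewrite /clamp; lia. Qed.

Lemma clampS k x : absz (clamp k.+1 x - clamp k x)%R <= 1.
Proof. rewrite /clamp; lia. Qed.

Lemma clamp_id k x : absz x <= k -> clamp k x = x.
Proof. rewrite /clamp; lia. Qed.

Lemma clamp0 x : clamp 0 x = 0%R.
Proof. rewrite /clamp; lia. Qed.

Lemma clampk0 k : clamp k 0 = 0%R.
Proof. rewrite /clamp; lia. Qed.

(** * Geodesics in hyperbolic groups *)

Section WordMetric.
Variables (G : groupType) (X : finType) (g : X -> G).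
Hypothesis g_gen : generates g.
Implicit Types (x y z o h : G) (w : word X).

Local Notation norm := (word_norm g).
Local Notation d := (word_dist g).

Lemma word_normP h : exists2 w, size w = norm h & eval g w = h.
Proof.
have [w wh] := g_gen h.
suff [w' []] : exists w' : word X, size w' = norm h /\ eval g w' = h by exists w'.
apply: (@leastP (fun k => exists w : word X, size w = k /\ eval g w = h)).
by exists (size w), w.
Qed.

Lemma word_norm_eval w : norm (eval g w) <= size w.
Proof. by apply: least_le; exists w. Qed.

Lemma word_normM x y : norm (x * y)%g <= norm x + norm y.
Proof.
have [u <- <-] := word_normP x; have [v <- <-] := word_normP y.
by rewrite -eval_cat -size_cat word_norm_eval.
Qed.

Lemma word_normV x : norm x^-1%g <= norm x.
Proof.
have [u <- <-] := word_normP x.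
by rewrite -eval_winv -size_winv word_norm_eval.
Qed.

Lemma word_dist_triangle y x z : d x z <= d x y + d y z.
Proof.
rewrite /word_dist (_ : x^-1 * z = (x^-1 * y) * (y^-1 * z))%g ?word_normM //.
by rewrite mulgA mulgK.
Qed.

Lemma word_dist_sym x y : d x y = d y x.
Proof.
have le u v : d u v <= d v u.
  by have := word_normV (v^-1 * u)%g; rewrite invgM invgK.
by apply/eqP; rewrite eqn_leq !le.
Qed.

Lemma word_dist1 x : d 1%g x = norm x.
Proof. by rewrite /word_dist invg1 mul1g. Qed.

Lemma word_distxx x : d x x = 0.
Proof.
apply/eqP; rewrite -leqn0 /word_dist mulVg -(eval_nil g).
exact: word_norm_eval.
Qed.

Definition geodesic h : word X :=
  xget [::] [set w : word X | size w = norm h /\ eval g w = h]%classic.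

Lemma geodesicP h : size (geodesic h) = norm h /\ eval g (geodesic h) = h.
Proof.
have [w sw ew] := word_normP h.
apply: (@xgetPex _ _ [set w : word X | size w = norm h /\ eval g w = h]%classic).
by exists w.
Qed.

(** The path rests at [h] from time [norm h] on, so geodesics of different lengths can be compared
    at all times. *)
Definition geo_pt h (k : nat) : G := eval g (take k (geodesic h)).

Lemma geo_pt0 h : geo_pt h 0 = 1%g.
Proof. by rewrite /geo_pt take0 eval_nil. Qed.

Lemma geo_pt_end h k : norm h <= k -> geo_pt h k = h.
Proof.
by have [sz ev] := geodesicP h => hk; rewrite /geo_pt take_oversize ?sz.
Qed.

Lemma geo_pt_diff h k : norm (geo_pt h k) <= k /\ d (geo_pt h k) h <= norm h - k.
Proof.
have [sz ev] := geodesicP h; split.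
  apply: leq_trans (word_norm_eval _) _; rewrite size_take; by case: ltnP.
rewrite /word_dist (_ : _ * h = eval g (drop k (geodesic h)))%g.
  by rewrite -sz -size_drop; exact: word_norm_eval.
by apply: (mulgI (geo_pt h k)); rewrite mulVKg -eval_cat cat_take_drop.
Qed.

Lemma geo_pt_dist h k : d (geo_pt h k) (geo_pt h k.+1) <= 1.
Proof.
rewrite /word_dist.
rewrite (_ : _ * _ = eval g (drop k (take k.+1 (geodesic h))))%g.
  by apply: leq_trans (word_norm_eval _) _; rewrite size_drop size_take_min; lia.
apply: (mulgI (geo_pt h k)); rewrite mulVKg -eval_cat.
by rewrite -[take k _](@take_takel _ k k.+1) // cat_take_drop.
Qed.

Lemma geo_pt_geodesic h k :
  norm (geo_pt h k) = minn k (norm h) /\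
  norm (geo_pt h k) + d (geo_pt h k) h = norm h.
Proof.
have [nk dk] := geo_pt_diff h k.
have := word_dist_triangle (geo_pt h k) 1%g h; rewrite !word_dist1.
have [kh|hk] := leqP k (norm h); first by lia.
by rewrite geo_pt_end ?word_distxx; lia.
Qed.

(** The inequality for Gromov products with denominators cleared, so that [E] plays the role of
    twice delta. *)
Definition four_point (E : nat) : Prop := forall o x y z,
  d x z + d o y <= maxn (d x y + d o z) (d y z + d o x) + E.

Lemma gromov_hyperbolic_four_point :
  gromov_hyperbolic (word_dist g) -> exists E, four_point E.
Proof.
move=> [delta d0 H]; exists (2 * Num.bound delta) => o x y z.
have bd : (delta < (Num.bound delta)%:R)%R by apply: archi_boundP.
move: (Num.bound delta) bd => n bd.
have := H o x y z; rewrite /gromov_product lerBlDr ge_min addn_maxl leq_max.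
by case/orP=> Hd; apply/orP; [left|right];
  rewrite mul2n -addnn -(ler_nat rat) !natrD; lra.
Qed.

Section Hyperbolic.
Variable E : nat.
Hypothesis hyp : four_point E.

(* Iterating the four-point inequality along a dyadic subdivision costs [E] per
   level. *)
Lemma dyadic_chain o (v : nat -> G) l s : exists i,
  d o (v i) + d o (v i.+1) + d (v s) (v (s + 2 ^ l)) <=
  d (v i) (v i.+1) + d o (v s) + d o (v (s + 2 ^ l)) + l * E.
Proof.
elim: l s => [|l IHl] s; first by exists s; rewrite addn1; lia.
have [i Hi] := IHl s; have [j Hj] := IHl (s + 2 ^ l).
have := hyp o (v s) (v (s + 2 ^ l)) (v (s + 2 ^ l + 2 ^ l)).
rewrite expnS mul2n -addnn addnA mulSn.
have [_|_] := leqP (d (v s) (v (s + 2 ^ l)) + d o (v (s + 2 ^ l + 2 ^ l)))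
   (d (v (s + 2 ^ l)) (v (s + 2 ^ l + 2 ^ l)) + d o (v s)) => H.
  by exists j; lia.
by exists i; lia.
Qed.

(** Seen from the point p of the geodesic, the endpoints 1 and [v i] have Gromov product 0. Hence
    [dyadic_chain] yields consecutive path vertices whose distances to p add up to at most
    [c + l * E]. *)
Lemma geodesic_near_path (v : nat -> G) c l i k :
    v 0 = 1%g -> (forall j, d (v j) (v j.+1) <= c) -> i <= 2 ^ l ->
  exists j, d (v j) (geo_pt (v i) k) <= c + l * E.
Proof.
move=> v0 vc il; set p := geo_pt (v i) k.
(* The path is frozen from time [i] on, so that its vertex at time [2 ^ l] is [v i]. *)
have [j] := dyadic_chain p (fun j => v (minn j i)) l 0.
have [_] := geo_pt_geodesic (v i) k; rewrite -/p.
rewrite add0n min0n v0 (minn_idPr il) word_dist1 (word_dist_sym p 1%g) word_dist1.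
have uc : d (v (minn j i)) (v (minn j.+1 i)) <= c.
  have [ji|ij] := ltnP j i; first by rewrite (minn_idPl ji).
  by rewrite (minn_idPr (leqW ij)) word_distxx.
by move=> pE H; exists (minn j i); rewrite word_dist_sym; lia.
Qed.

(** If one geodesic has ended by time [k], the other has at most [c] left to go, which gives
    [2 * c]. Otherwise the four-point inequality based at 1 is used twice, first to bound the
    distance from the point on the first geodesic to [h'], then to the point on the second. *)
Lemma geodesics_fellow_travel h h' c k : d h h' <= c ->
  d (geo_pt h k) (geo_pt h' k) <= 2 * c + 2 * E.
Proof.
move=> hc.
have end_case u v : d u v <= c -> norm u <= k ->
    d (geo_pt u k) (geo_pt v k) <= 2 * c + 2 * E.
  move=> uv uk; rewrite geo_pt_end //.
  have := word_dist_triangle v u (geo_pt v k).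
  have [_] := geo_pt_diff v k; rewrite (word_dist_sym _ v).
  by have := word_dist_triangle u 1%g v; rewrite !word_dist1; lia.
have [hk|kh] := leqP (norm h) k; first exact: end_case.
have [hk'|kh'] := leqP (norm h') k.
  by rewrite word_dist_sym; apply: end_case; rewrite // word_dist_sym.
have [np dp] := geo_pt_geodesic h k; have [nq dq] := geo_pt_geodesic h' k.
have := hyp 1%g (geo_pt h k) h h'.
have := hyp 1%g (geo_pt h k) h' (geo_pt h' k).
rewrite !word_dist1 (word_dist_sym h' (geo_pt h' k)).
have := word_dist_triangle h 1%g h'; have := word_dist_triangle h' 1%g h.
rewrite !word_dist1 (word_dist_sym h' h).
by lia.
Qed.

End Hyperbolic.

Lemma ball_finite (M : nat) : exists S : seq G, forall h, norm h <= M -> h \in S.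
Proof.
exists (flatten
  [seq [seq eval g (w : word X) | w : k.-tuple (X * bool)] | k <- iota 0 M.+1]).
move=> h hM; have [w sw <-] := word_normP h.
apply/flattenP; exists [seq eval g (w : word X) | w : (norm h).-tuple (X * bool)].
  by apply/mapP; exists (norm h); rewrite ?mem_iota.
have sw' : size w == norm h by apply/eqP.
by apply/mapP; exists (Tuple sw'); rewrite ?mem_enum.
Qed.

End WordMetric.

(** * Polynomial isoperimetric inequality *)

Lemma leq_expl m n e : m <= n -> m ^ e <= n ^ e.
Proof. by case: e => // e; rewrite leq_exp2r. Qed.

(** Here the exponential of a logarithm becomes a power: with t the logarithm, (3K)^b is at most
    2^(3Kb) and 2^t at most n + 1. The left side counts [n] ladders of [2 * (c * n) + 2] cells
    each. *)
Lemma poly_bound (c K a b n : nat) :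
  n * ((2 * (c * n) + 2) * growth K (a + b * (trunc_log 2 n.+1).+1).+1) <=
  (2 * c + 2) * K * (3 * K) ^ (a + b).+1 * n.+1 ^ (2 + 3 * K * b).
Proof.
set t := trunc_log 2 n.+1.
have tn : 2 ^ t <= n.+1 by apply: trunc_logP.
have pt : ((3 * K) ^ b) ^ t <= n.+1 ^ (3 * K * b).
  have K2 : (3 * K) ^ b <= 2 ^ (3 * K * b).
    by rewrite expnM; apply: leq_expl; apply: ltnW; apply: ltn_expl.
  apply: leq_trans (leq_expl _ K2) _.
  by rewrite -expnM mulnC expnM; apply: leq_expl.
rewrite /growth (_ : (a + b * t.+1).+1 = (a + b).+1 + b * t); last by lia.
rewrite expnD (expnM _ b t) expnD.
have n2 : n * (2 * (c * n) + 2) <= (2 * c + 2) * n.+1 ^ 2 by rewrite expnS expn1; nia.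
move: (((3 * K) ^ b) ^ t) (n.+1 ^ (3 * K * b)) pt => p q pq.
rewrite [n * _]mulnA; move: ((3 * K) ^ (a + b).+1) (n * _) (n.+1 ^ 2) n2 => r m N mN.
rewrite [K * (r * p)]mulnA.
have -> : (2 * c + 2) * K * r * (N * q) = ((2 * c + 2) * N) * ((K * r) * q).
  by rewrite -[in RHS]mulnA -!(mulnA (2 * c + 2)) (mulnCA N) mulnA.
exact: leq_mul mN (leq_mul (leqnn _) pq).
Qed.

Section Filling.
Variables (G : groupType) (V : zmodType) (phi : G -> V).
Hypothesis phiM : forall x y, phi (x * y)%g = (phi x + phi y)%R.
Variables (Y : finType) (R : seq (word Y)) (f : Y -> G).
Hypothesis phi_f : forall w, phi (eval f w) = 0%R.
Hypothesis f_onto : forall h, phi h = 0%R -> exists w, eval f w = h.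
Hypothesis f_ker : forall w, eval f w = 1%g -> exists k, is_conj_prod R k w.
Hypothesis f_rel : forall r, r \in R -> eval f r = 1%g.
Variables (X : finType) (g : X -> G).
Hypothesis g_gen : generates g.
Variable E : nat.
Hypothesis hyp : four_point g E.

Local Notation norm := (word_norm g).
Local Notation d := (word_dist g).

Let ts : seq V := [seq phi (g x) | x <- enum X].

Lemma im_comb z : im phi (comb ts z).
Proof.
have imt t : t \in ts -> im phi t by case/mapP=> x _ ->; exists (g x).
have imMn u k : im phi u -> im phi (u *+ k)%R.
  by move=> iu; elim: k => [|k IHk]; [apply: im0 | rewrite mulrS; apply: imD].
elim: ts imt z => [|t s IHs] imt z /=; first exact: im0.
apply: imD => //; last by apply: IHs => u us; apply: imt; rewrite inE us orbT.
have it := imt t (mem_head _ _).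
case: (z 0%N) => n; first exact: imMn.
by rewrite -[(_ *~ _)%R]sub0r; apply: imB; [|apply: im0|apply: imMn].
Qed.

Lemma span_phi h : span ts (phi h).
Proof.
have [w <-] := g_gen h; elim: w => [|[x b] w IHw].
  by rewrite eval_nil phi1 //; apply: span0.
rewrite -cat1s eval_cat phiM eval1; apply: spanD => //.
have sx : span ts (phi (g x)) by apply: mem_span; apply/map_f/mem_enum.
by case: b; rewrite /eval_letter //= phiV //; apply: spanN.
Qed.

(** The finitely many letters share one constant [C], which is then added up along a shortest word
    from [h] to [k]. *)
Lemma lipschitz_word_dist : exists (lambda : V -> nat -> int) (C : nat),
  [/\ forall h, comb ts (lambda (phi h)) = phi h,
      forall i, lambda 0%R i = 0%R
    & forall h k i, absz (lambda (phi k) i - lambda (phi h) i)%R <= C * d h k].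
Proof.
have [lambda [lamP lam0 lamL]] := lipschitz_coordinates ts.
have [C CP] : exists C, forall a : letter X, a \in enum {: letter X} ->
    forall v, span ts v -> forall i,
    absz (lambda (v + phi (eval g [:: a])) i - lambda v i)%R <= C.
  apply: (@uniform_bound _ _ (fun a C => forall v, span ts v -> forall i,
    absz (lambda (v + phi (eval g [:: a])) i - lambda v i)%R <= C)).
    by move=> a k l kl H v sv i; apply: leq_trans kl; apply: H.
  by move=> a _; apply/lamL/span_phi.
exists lambda, C; split=> [h||h k i] //; first exact/lamP/span_phi.
have [w] := word_normP g_gen (h^-1 * k)%g.
rewrite -/(d h k) => <- wE.
have {wE} -> : k = (h * eval g w)%g by rewrite wE mulVKg.
elim: w h => [|a w IHw] h; first by rewrite eval_nil mulg1 subrr.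
rewrite -cat1s eval_cat mulgA size_cat mulnDr.
have := IHw (h * eval g [:: a])%g.
have := CP a (mem_enum _ _) (phi h) (span_phi h) i.
rewrite -phiM muln1.
by move: (lambda _ i) (lambda _ i) (lambda _ i) => p q r; lia.
Qed.

(** * Filling a single loop of the kernel *)

Section Loop.
Variables (lambda : V -> nat -> int) (C : nat).
Hypothesis lamP : forall h, comb ts (lambda (phi h)) = phi h.
Hypothesis lam0 : forall i, lambda 0%R i = 0%R.
Hypothesis lamL : forall h k i,
  absz (lambda (phi k) i - lambda (phi h) i)%R <= C * d h k.
Variables (D : seq V) (S : seq G) (c0 : nat).
(** Bounds every edge of the ladders: rungs have length at most [2 * c0 + 2 * E] by fellow
    travelling, and diagonals are longer by at most 1. Along such an edge the coordinates change by
    at most [C * M]. *)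
Let M := (2 * c0 + 2 * E).+1.
Hypothesis D_im : forall v, v \in D -> im phi v.
Hypothesis D_comb : forall z, (forall i, absz (z i) <= C * M + 1) -> comb ts z \in D.
Hypothesis S_ball : forall h, norm h <= M -> h \in S.
Hypothesis c0P : forall a : letter Y, norm (eval f [:: a]) <= c0.
Variable K : nat.
Hypothesis KP : push_bound phi R f D S K.
Variable n : nat.

(** The cost of one pushed triangle. Here [n] is the number of pushing steps, not the length of the
    loop. *)
Let cell := growth K n.+1.

Definition descent (h : G) (j : nat) : V :=
  comb ts (fun i => clamp (n - j) (lambda (phi h) i)).

Definition shallow (h : G) : Prop := forall i, absz (lambda (phi h) i) <= n.

Definition pushed_edge (h k : G) : word Y :=
  push phi f (descent h) (descent k) (h^-1 * k)%g n.

Lemma D_zero : 0%R \in D.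
Proof. by rewrite -(comb0 ts); apply: D_comb => i. Qed.

Lemma descent_steps h : steps_in D (descent h).
Proof.
move=> j; rewrite /descent -combB; apply: D_comb => i.
case: (n - j) (subnS n j) => [|k] ->; first by rewrite subrr.
by apply: leq_trans (clampS _ _) _; rewrite addn1.
Qed.

Lemma descent_close h k : d h k <= M -> close D (descent h) (descent k).
Proof.
move=> hk j; rewrite /descent -combB; apply: D_comb => i.
apply: leq_trans (clamp_lipschitz _ _ _) _.
apply: leq_trans (lamL _ _ _) _.
by apply: leq_trans (leq_addr _ _); rewrite leq_mul2l hk orbT.
Qed.

Lemma descent0 h : shallow h -> descent h 0 = phi h.
Proof.
move=> sh; rewrite -[RHS]lamP; apply: eq_comb => i.
by rewrite subn0 clamp_id.
Qed.

Lemma descent_end h : descent h n = 0%R.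
Proof. by rewrite -(comb0 ts); apply: eq_comb => i; rewrite subnn clamp0. Qed.

Lemma pushed_edge_mul h k l : shallow h -> shallow k -> shallow l ->
    d h k <= M -> d k l <= M -> d h l <= M ->
  weq R cell (pushed_edge h k ++ pushed_edge k l) (pushed_edge h l).
Proof.
move=> sh sk sl hk kl hl; rewrite /pushed_edge.
have -> : (h^-1 * l = (h^-1 * k) * (k^-1 * l))%g by rewrite mulgA mulgK.
apply: (push_mul (D := D) (S := S)) => //;
  do ?[exact: descent_steps | exact: descent_close | exact: descent_end
      | exact: S_ball].
- exact: D_zero.
- by rewrite !descent0 // phiM phiV // addrC.
- by rewrite !descent0 // phiM phiV // addrC.
Qed.

Fixpoint walk (h : G) (k : nat) : word Y :=
  if k is j.+1 then walk h j ++ pushed_edge (geo_pt g h j) (geo_pt g h j.+1)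
  else [::].

(** Each square between the two geodesics is cut by a diagonal into two triangles, one cell each.
    The additional cell pays for the degenerate rung at 1. *)
Lemma walk_ladder h h' k : d h h' <= c0 ->
    (forall j, shallow (geo_pt g h j)) -> (forall j, shallow (geo_pt g h' j)) ->
  weq R ((2 * k + 1) * cell)
    (walk h k ++ pushed_edge (geo_pt g h k) (geo_pt g h' k)) (walk h' k).
Proof.
move=> hh' sh sh'.
have rung j : d (geo_pt g h j) (geo_pt g h' j) < M.
  exact: geodesics_fellow_travel.
have step u j : d (geo_pt g u j) (geo_pt g u j.+1) <= 1 by apply: geo_pt_dist.
have diag j : d (geo_pt g h j) (geo_pt g h' j.+1) <= M.
  have := word_dist_triangle g_gen (geo_pt g h' j) (geo_pt g h j) (geo_pt g h' j.+1).
  by have := rung j; have := step h' j; lia.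
elim: k => [|k IHk].
  rewrite mul1n /= geo_pt0 geo_pt0.
  (* The pushed degenerate edge equals its own square at the cost of one cell, hence is trivial. *)
  apply: (@weq_cancell _ _ (pushed_edge 1 1)); rewrite cats0.
  have s1 : shallow 1 by rewrite -(geo_pt0 g h).
  by apply: pushed_edge_mul; rewrite // word_distxx.
rewrite /= -catA.
have s1 j u : d (geo_pt g u j) (geo_pt g u j.+1) <= M.
  by apply: leq_trans (step u j) _.
have H1 := pushed_edge_mul (sh k) (sh k.+1) (sh' k.+1) (s1 k h) (ltnW (rung _)) (diag k).
have H2 := pushed_edge_mul (sh k) (sh' k) (sh' k.+1) (ltnW (rung _)) (s1 k h') (diag k).
have := weq_trans (weq_catl (walk h k) H1) (weq_catl (walk h k) (weq_sym H2)).
move/weq_trans_leq; apply.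
  rewrite catA; exact: weq_catr IHk.
by lia.
Qed.

(** Vertices of the kernel have all coordinates 0, so their descents are constant and pushing gives
    back the generator. *)
Lemma kernel_edge w (a : letter Y) :
  weq R cell (pushed_edge (eval f w) (eval f (w ++ [:: a]))) [:: a].
Proof.
have descentN u : descent (eval f u) = fun=> 0%R.
  apply: funext => j; rewrite -(comb0 ts); apply: eq_comb => i.
  by rewrite phi_f lam0 clampk0.
rewrite /pushed_edge !descentN eval_cat mulKg.
have aS : eval f [:: a] \in S by apply: S_ball; have := c0P a; lia.
apply: weq_leq (push_const D_zero KP n aS).
rewrite /cell growthS; have := push_bound_gt0 KP.
by have := growth_gt0 n (push_bound_gt0 KP); nia.
Qed.

Lemma weq_loop w : eval f w = 1%g ->
    (forall i k, shallow (geo_pt g (eval f (take i w)) k)) ->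
  weq R (size w * ((2 * (c0 * size w) + 2) * cell)) w [::].
Proof.
(* [T] bounds the norm of every vertex of the loop, so at time [T] all geodesics have arrived and
   the last rung is an edge of the loop. *)
move=> w1 shal; set T := c0 * size w.
pose v i := eval f (take i w).
have norm_v i : i <= size w -> norm (v i) <= c0 * i.
  elim: i => [_|i IHi iw].
    rewrite /v take0 eval_nil -(eval_nil g) muln0; exact: word_norm_eval.
  have y0 : letter Y by case: (w) iw.
  rewrite /v (take_nth y0) // -cats1 eval_cat mulnS addnC.
  apply: leq_trans (word_normM g_gen _ _) _.
  by apply: leq_add; [apply/IHi/ltnW | apply: c0P].
(* The loop is coned off from 1 one letter at a time: a ladder costs [2 * T + 1] cells and
   [kernel_edge] one more. For [i = size w] both walks are [walk 1 T], which cancels. *)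
have main i : i <= size w ->
    weq R (i * ((2 * T + 2) * cell)) (walk 1 T ++ take i w) (walk (v i) T).
  elim: i => [_|i IHi iw].
    rewrite /v take0 eval_nil cats0; exact: weq_refl.
  have y0 : letter Y by case: (w) iw.
  have vS : v i.+1 = eval f (take i w ++ [:: nth y0 w i]).
    by rewrite /v (take_nth y0) // -cats1.
  have viT : norm (v i) <= T.
    by apply: leq_trans (norm_v i (ltnW iw)) _; rewrite leq_mul2l (ltnW iw) orbT.
  have vSiT : norm (v i.+1) <= T.
    by apply: leq_trans (norm_v i.+1 iw) _; rewrite leq_mul2l iw orbT.
  have vv : d (v i) (v i.+1) <= c0.
    by rewrite vS /word_dist eval_cat mulKg.
  have := walk_ladder T vv (shal i) (shal i.+1).
  rewrite !geo_pt_end // => HL.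
  have HE := kernel_edge (take i w) (nth y0 w i); rewrite -vS in HE.
  rewrite (take_nth y0) // -cats1 catA.
  apply: weq_trans_leq (weq_catr [:: nth y0 w i] (IHi (ltnW iw))) _ _.
    exact: weq_trans (weq_catl (walk (v i) T) (weq_sym HE)) HL.
  by lia.
have := main (size w) (leqnn _).
rewrite /v take_size w1 -[X in weq _ _ _ X]cats0; exact: weq_cancell.
Qed.

End Loop.

Theorem area_polynomial : exists c e : nat, forall w : word Y,
  eval f w = 1%g -> forall n, size w <= n -> area R w <= c * n.+1 ^ e.
Proof.
have [lambda [C [lamP lam0 lamL]]] := lipschitz_word_dist.
pose c0 := \max_(a : letter Y) norm (eval f [:: a]).
have c0P a : norm (eval f [:: a]) <= c0.
  exact: (leq_bigmax (F := fun a : letter Y => norm (eval f [:: a]))).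
pose M := (2 * c0 + 2 * E).+1.
have [D' D'P] := comb_bounded_finite ts (C * M + 1).
(* [D'] may contain elements outside the image of [phi]; filtering loses no combination, by
   [im_comb]. *)
pose D := [seq v <- D' | `[< im phi v >]].
have D_im v : v \in D -> im phi v by rewrite mem_filter => /andP[/asboolP].
have D_comb z : (forall i, absz (z i) <= C * M + 1) -> comb ts z \in D.
  by move=> /D'P zD; rewrite mem_filter zD andbT; apply/asboolP/im_comb.
have D0 : 0%R \in D by rewrite -(comb0 ts); apply: D_comb.
have [S SP] := ball_finite g_gen M.
have [K KP] := push_bound_exists phiM phi_f f_onto f_ker f_rel S D_im D0.
exists ((2 * c0 + 2) * K * (3 * K) ^ (C * c0 + C * E).+1), (2 + 3 * K * (C * E)).
move=> w w1 n wn.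
apply: leq_trans (_ : _ <= (2 * c0 + 2) * K * (3 * K) ^ (C * c0 + C * E).+1 *
   (size w).+1 ^ (2 + 3 * K * (C * E))) _; last first.
  by rewrite leq_mul2l leq_expl ?orbT.
apply: leq_trans (poly_bound _ _ _ _ _); apply: area_weq.
set l := (trunc_log 2 (size w).+1).+1.
(* The number of pushing steps: vertices of the cone lie within [c0 + l * E] of the loop, where the
   coordinates vanish, so their coordinates are at most [C] times this distance. *)
apply: (@weq_loop lambda C lamP lam0 lamL D S c0 D_comb SP c0P K KP
  (C * c0 + C * E * l) w w1) => i k m.
have wl : size w <= 2 ^ l.
  by apply/ltnW/ltnW; apply: trunc_log_ltn.
pose v j := eval f (take j w).
have v0 : v 0 = 1%g by rewrite /v take0 eval_nil.
have vc j : d (v j) (v j.+1) <= c0.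
  have [jw|wj] := ltnP j (size w); last first.
    by rewrite /v !take_oversize ?(leqW wj) // word_distxx.
  have y0 : letter Y by case: (w) jw.
  by rewrite /v (take_nth y0) // -cats1 /word_dist eval_cat mulKg.
have il : minn i (size w) <= 2 ^ l by apply: leq_trans (geq_minr _ _) wl.
have [j Hj] := geodesic_near_path g_gen hyp k v0 vc il.
have vi : v (minn i (size w)) = eval f (take i w).
  rewrite /v; congr eval; case: leqP => // wi.
  by rewrite take_size take_oversize // ltnW.
rewrite vi in Hj.
have := lamL (v j) (geo_pt g (eval f (take i w)) k) m.
rewrite [phi (v j)]phi_f lam0 subr0 => /leq_trans; apply.
by rewrite -mulnA -mulnDr leq_mul2l (mulnC E) Hj orbT.
Qed.

End Filling.

(** * Additive notation for the quotient and the bound on the Dehn function *)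

Section AbelianGroup.
Variables (Q : groupType) (abQ : forall x y : Q, commute x y).

(** An alias of [Q] that mentions [abQ], so that the additive structure can be attached to it with
    commutativity at hand. *)
Definition additive_group : Type := let _ := abQ in Q.

HB.instance Definition _ := Choice.on additive_group.

Let addA : associative (fun x y : additive_group => (x * y)%g : additive_group).
Proof. exact: mulgA. Qed.
Let addC : commutative (fun x y : additive_group => (x * y)%g : additive_group).
Proof. exact: abQ. Qed.
Let add0 : left_id (1%g : additive_group) (fun x y : additive_group => (x * y)%g).
Proof. exact: mul1g. Qed.
Let addN : left_inverse (1%g : additive_group)
  (fun x : additive_group => x^-1%g) (fun x y : additive_group => (x * y)%g).
Proof. exact: mulVg. Qed.

HB.instance Definition _ :=
  GRing.isZmodule.Build additive_group addA addC add0 addN.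

End AbelianGroup.

Theorem theorem1p1 (G Q : groupType) (phi : {multiplicative G -> Q})
    (hypG : hyperbolic_group G)
    (fgQ : finitely_generated Q)
    (abQ : forall x y : Q, commute x y)
    (fpN : finitely_presented (kernel phi : groupType))
    (P : finite_presentation (kernel phi : groupType)) :
  exists p : {poly rat}, forall n : nat, ((dehn P n)%:R <= p.[n%:R])%R.
Proof.
have [X [g [g_gen /gromov_hyperbolic_four_point[E hyp]]]] := hypG.
pose f (y : pres_gens P) : G := kernel_val (pres_map y).
pose psi (x : G) : additive_group abQ := phi x.
have valM (x y : kernel phi) : kernel_val (x * y)%g = (kernel_val x * kernel_val y)%g.
  exact: valM.
have val1 : kernel_val (1%g : kernel phi) = 1%g by exact: val1.
have valV (x : kernel phi) : kernel_val x^-1%g = (kernel_val x)^-1%g.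
  by apply: (mulgI (kernel_val x)); rewrite -valM !mulgV val1.
have evalE w : eval f w = kernel_val (eval (@pres_map _ P) w).
  elim: w => [|a w IHw]; first by rewrite !eval_nil val1.
  rewrite -cat1s !eval_cat valM IHw !eval1 /eval_letter.
  by case: a.2; rewrite ?valV.
have psiM x y : psi (x * y)%g = (psi x + psi y)%R by rewrite /psi gmulfM.
have psi_f w : psi (eval f w) = 0%R.
  rewrite evalE; case: (eval _ _) => x /=; rewrite unfold_in => /eqP; exact.
have f_onto h : psi h = 0%R -> exists w, eval f w = h.
  move=> /eqP psih; have [w wh] := @pres_generates _ P (Kernel psih).
  by exists w; rewrite evalE wh.
have ker1 w : eval f w = 1%g <-> eval (@pres_map _ P) w = 1%g.
  by rewrite evalE; split=> [e|->]; [apply/val_inj/(etrans e) | exact: val1].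
have f_ker w : eval f w = 1%g -> exists k, is_conj_prod (pres_rels P) k w.
  by move=> /ker1/pres_ker.
have f_rel r : r \in pres_rels P -> eval f r = 1%g.
  (* A relator is a product of one conjugate, with empty conjugator. *)
  move=> Pr; apply/ker1/pres_ker; exists 1; exists [:: ([::], r)]; split=> //.
    by move=> p; rewrite inE => /eqP ->; rewrite mem_cat Pr.
  by rewrite /conj_prod /= !cats0; apply: freely_equal_refl.
have [c [e area_le]] :=
  area_polynomial psiM psi_f f_onto f_ker f_rel g_gen hyp.
exists (c%:R *: ('X + 1) ^+ e)%R => n.
rewrite hornerZ horner_exp hornerD hornerX hornerC.
rewrite natr1 -natrX -natrM ler_nat.
apply/bigmax_leqP => l _; apply/bigmax_leqP => w /asboolP w1.
by apply: area_le; [apply/ker1 | rewrite size_tuple -ltnS].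
Qed.
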